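(* Let $G$ be a graph and let $v$ be a vertex of $G$. Then $st_{\gamma_2}(G) \le st_{\gamma_2}(G-v)+1$.
   Context: All graphs are finite, simple and undirected. For a graph $G=(V,E)$, a subset $D \subseteq V$ is a 2-dominating set if every vertex $v \in V \setminus D$ has at least two neighbors in $D$. The 2-domination number $\gamma_2(G)$ is the minimum cardinality of a 2-dominating set of $G$. The stability of the 2-domination number, $st_{\gamma_2}(G)$, is the minimum number of vertices whose removal from $G$ (deleting the vertices and all incident edges) changes the 2-domination number, i.e. the minimum of $|S|$ over $S\subseteq V$ with $\gamma_2(G-S)\ne\gamma_2(G)$. $G-v$ is the graph obtained from $G$ by deleting $v$ and all edges incident to it. *)

(* Defs.v *)
From mathcomp Require Import all_boot.

Set Implicit Arguments.
Unset Strict Implicit.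
Unset Printing Implicit Defensive.

Record sgraph := SGraph {
  vertex :> finType;
  edge : rel vertex;
  edge_sym : symmetric edge;
  edge_irrefl : irreflexive edge
}.

(** The graph [G - S]: the subgraph induced on the complement of [S]. *)
Section VertexDeletion.
Variables (G : sgraph) (S : {set G}).

Definition del_edge : rel {x : G | x \notin S} :=
  fun x y => edge (val x) (val y).

Lemma del_edge_sym : symmetric del_edge.
Proof. by move=> x y; rewrite /del_edge edge_sym. Qed.

Lemma del_edge_irrefl : irreflexive del_edge.
Proof. by move=> x; rewrite /del_edge edge_irrefl. Qed.

Definition del_vertices : sgraph := SGraph del_edge_sym del_edge_irrefl.

End VertexDeletion.

Definition del_vertex (G : sgraph) (v : G) : sgraph := del_vertices [set v].

Definition two_dominating (G : sgraph) (D : {set G}) : bool :=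
  [forall v, (v \notin D) ==> (1 < #|[set u in D | edge v u]|)].

Definition gamma2 (G : sgraph) : nat :=
  #|[arg min_(D < [set: G] | two_dominating D) #|D|]|.

(** If [G] has a vertex, deleting all of [V(G)] changes [gamma2] from a
    positive value to [0], so the minimum below is over a nonempty family. The
    graph without vertices has no admissible set; there [arg min] falls back
    on its default [setT], which gives [st_gamma2 G = 0]. *)
Definition st_gamma2 (G : sgraph) : nat :=
  #|[arg min_(S < [set: G] | gamma2 (del_vertices S) != gamma2 G) #|S|]|.

Lemma two_dominatingT (G : sgraph) : two_dominating [set: G].
Proof. by apply/forallP => v; rewrite in_setT. Qed.

Lemma gamma2_attained (G : sgraph) :
  exists2 D : {set G}, two_dominating D & #|D| = gamma2 G.
Proof.
by rewrite /gamma2; case: arg_minnP => [|D domD _];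
  [exact: two_dominatingT | exists D].
Qed.

Lemma gamma2_min (G : sgraph) (D : {set G}) :
  two_dominating D -> gamma2 G <= #|D|.
Proof.
move=> domD; rewrite /gamma2; case: arg_minnP => [|D0 _ minD0];
  [exact: two_dominatingT | exact: minD0].
Qed.

Lemma gamma2_gt0 (G : sgraph) : 0 < #|G| -> 0 < gamma2 G.
Proof.
case/card_gt0P => v _; case: (gamma2_attained G) => D /forallP/(_ v) + <-.
rewrite card_gt0; apply: contraTneq => ->; rewrite in_set0 /= -leqNgt.
by rewrite (@eq_card0 _ [set u in set0 | edge v u]) // => u; rewrite !inE.
Qed.

Lemma gamma2_delT (G : sgraph) : gamma2 (del_vertices [set: G]) = 0.
Proof.
case: (gamma2_attained (del_vertices [set: G])) => D _ <-.
by apply: eq_card0 => x; case: (negP (valP x)); rewrite in_setT.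
Qed.

Lemma st_gamma2_attained (G : sgraph) : 0 < #|G| ->
  exists2 S : {set G}, gamma2 (del_vertices S) != gamma2 G & #|S| = st_gamma2 G.
Proof.
move=> G0; rewrite /st_gamma2; case: arg_minnP => [|S neS _]; last by exists S.
by rewrite gamma2_delT eq_sym -lt0n gamma2_gt0.
Qed.

Lemma st_gamma2_min (G : sgraph) (S : {set G}) :
  gamma2 (del_vertices S) != gamma2 G -> st_gamma2 G <= #|S|.
Proof.
move=> neS; rewrite /st_gamma2.
case: (posnP #|G|) => [G0 | G0].
  by apply: leq_trans (max_card _) _; rewrite G0.
case: arg_minnP => [|S0 _ minS0]; last exact: minS0.
by rewrite gamma2_delT eq_sym -lt0n gamma2_gt0.
Qed.

(* Main.v *)
Require Import Defs.
From mathcomp Require Import all_boot.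

(** If deleting [v] alone changes the 2-domination number, the stability of [G] is at most 1.
    Otherwise [G - v] and [G] share that number, so a smallest [T] changing it in [G - v] yields the
    set [T] plus [v], which changes it in [G] and has at most one more vertex. This rests on
    [gamma2_del_del]: deleting [v] and then [T] is deleting both at once. *)

Lemma gamma2_iso_le (G H : sgraph) (f : G -> H) :
  bijective f -> {mono f : x y / edge x y} -> gamma2 H <= gamma2 G.
Proof.
move=> [g fK gK] f_edge; have [D /forallP domD <-] := gamma2_attained G.
have f_inj := can_inj fK; rewrite -(card_imset _ f_inj); apply: gamma2_min.
apply/forallP=> y; rewrite -[y]gK (mem_imset _ _ f_inj); apply/implyP=> gyD.
(* [f] sends the neighbors of [g y] in [D] injectively to neighbors of [y] in the image of [D]. *)
apply: leq_trans (implyP (domD (g y)) gyD) _; rewrite -(card_imset _ f_inj).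
apply/subset_leq_card/subsetP=> _ /imsetP[x + ->].
by rewrite !inE f_edge (mem_imset _ _ f_inj).
Qed.

Lemma gamma2_iso (G H : sgraph) (f : G -> H) :
  bijective f -> {mono f : x y / edge x y} -> gamma2 G = gamma2 H.
Proof.
move=> f_bij f_edge; apply/eqP; rewrite eqn_leq (gamma2_iso_le _ _ f) // andbT.
have [g fK gK] := f_bij; apply: (gamma2_iso_le _ _ g); first by exists f.
by move=> x y; rewrite -f_edge !gK.
Qed.

(** The two graphs live on different types, a nested subtype and a single one, so they are only
    isomorphic; [gamma2_iso] bridges the gap. *)
Lemma gamma2_del_del (G : sgraph) (S : {set G}) (T : {set del_vertices S}) :
  gamma2 (del_vertices T) = gamma2 (del_vertices (S :|: [set val x | x in T])).
Proof.
set U := S :|: _.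
have notinU (x : del_vertices T) : val (val x) \notin U.
  by rewrite inE negb_or (valP (val x)) (mem_imset _ _ val_inj) (valP x).
have notinS (y : del_vertices U) : val y \notin S.
  by have := valP y; rewrite inE negb_or => /andP[].
pose y1 (y : del_vertices U) : del_vertices S := exist _ (val y) (notinS y).
have notinT y : y1 y \notin T.
  apply: contra (valP y) => yT; rewrite inE; apply/orP; right.
  by apply/imsetP; exists (y1 y).
pose f (x : del_vertices T) : del_vertices U := exist _ (val (val x)) (notinU x).
pose g (y : del_vertices U) : del_vertices T := exist _ (y1 y) (notinT y).
(* Both edge relations compute to that of [G] on the underlying vertices. *)
apply: (@gamma2_iso (del_vertices T) (del_vertices U) f) => //.
by exists g => x; do !apply: val_inj.
Qed.

Theorem proposition3p1 (G : sgraph) (v : G) :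
  st_gamma2 G <= st_gamma2 (del_vertex v) + 1.
Proof.
have [eq_v | neq_v] := eqVneq (gamma2 (del_vertex v)) (gamma2 G); last first.
  by rewrite (leq_trans (st_gamma2_min neq_v)) // cards1 leq_addl.
(* On an empty graph [st_gamma2] is a default value attained by no admissible set. Here [G - v] is
   nonempty because its [gamma2] equals that of [G], which is positive. *)
have Gv_gt0 : 0 < #|del_vertex v|.
  have [D _ cardD] := gamma2_attained (del_vertex v).
  apply: leq_trans (max_card (mem D)); rewrite cardD eq_v gamma2_gt0 //.
  by apply/card_gt0P; exists v.
have [T neqT <-] := st_gamma2_attained Gv_gt0.
rewrite eq_v gamma2_del_del in neqT.
apply: leq_trans (st_gamma2_min neqT) _.
apply: leq_trans (leq_card_setU _ _) _.
by rewrite cards1 addnC leq_add2r leq_imset_card.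
Qed.
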